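(* For every $k\ge 2$, over any field $\mathbb F$ of characteristic $\neq 2$: the ideal $I_k\subset R_k$ has exactly $k-1$ irreducible, radical, primary components, namely the ideals $P_2,\dots,P_k$ of $R_k$, and $$I_k=P_2\cap\cdots\cap P_k$$ is an irredundant primary decomposition of $I_k$ into $k-1$ prime ideals.
   Context: $\mathbb F$ is a field of characteristic $\neq 2$. For $k\ge 2$, $R_k$ is the polynomial ring over $\mathbb F$ in the $3k$ variables $v_{i,c}$ ($1\le i\le k$, $c=1,2,3$), and $\overline v_i=(v_{i,1},v_{i,2},v_{i,3})\in R_k^3$. Let $S=\mathrm{diag}(-1,-1,1)$ and let $a\times b=(a_2b_3-a_3b_2,\;a_3b_1-a_1b_3,\;a_1b_2-a_2b_1)$ be the cross product. Define recursively $\overline w_2=\overline v_1\times\overline v_2$ and $\overline w_j=S(\overline w_{j-1})\times\overline v_j$ for $j\ge 3$; each $\overline w_j$ is a triple of polynomials in $\overline v_1,\dots,\overline v_j$, hence a polynomial map $\mathbb A^{3j}\to\mathbb A^3$. $I_k\subset R_k$ is the ideal generated by the three components of $\overline w_k$. For $j\ge 3$ define $\Phi_j:\mathbb A^{3(j-1)}\times\mathbb A^1\to\mathbb A^{3j}$ by $\Phi_j(p,\lambda)=(p,\lambda S(\overline w_{j-1}(p)))$, and for $j=2$ define $\Phi_2(p,\lambda)=(p,\lambda p)$. For $2\le j\le k$ let $\Psi_j:\mathbb A^{3(j-1)}\times\mathbb A^1\times\mathbb A^{3(k-j)}\to\mathbb A^{3k}$, $\Psi_j(p,\lambda,q)=(\Phi_j(p,\lambda),q)$.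 Let $\varphi_j:R_k\to\mathbb F[p,\lambda,q]$ be the corresponding $\mathbb F$-algebra homomorphism into the polynomial ring in $3k-2$ variables (the coordinates of $p$, $\lambda$, $q$), sending each variable $v_{i,c}$ to the corresponding coordinate polynomial of $\Psi_j$. Then $P_j:=\ker\varphi_j\subset R_k$. *)

(* Defs.v *)
From mathcomp Require Import all_boot all_order all_algebra.
From mathcomp Require Import mpoly.

Set Implicit Arguments.
Unset Strict Implicit.
Unset Printing Implicit Defensive.

Import GRing.Theory.
Local Open Scope ring_scope.

Section Ideals.

Variable R : comNzRingType.

(* Ideals are Prop-valued since membership in a finitely generated ideal comes
   with no decision procedure. *)
Implicit Types (J : R -> Prop).

Definition is_ideal J : Prop :=
  J 0 /\ forall a f g, J f -> J g -> J (a * f + g).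

Definition same_ideal J1 J2 : Prop := forall f, J1 f <-> J2 f.

Definition radical J : R -> Prop := fun f => exists n : nat, J (f ^+ n).

Definition radical_ideal J : Prop := is_ideal J /\ same_ideal (radical J) J.

Definition prime_ideal J : Prop :=
  [/\ is_ideal J, ~ J 1 & forall f g, J (f * g) -> J f \/ J g].

Definition primary_ideal J : Prop :=
  [/\ is_ideal J, ~ J 1 & forall f g, J (f * g) -> J f \/ radical J g].

Definition irreducible_ideal J : Prop :=
  [/\ is_ideal J, ~ J 1 &
    forall A B, is_ideal A -> is_ideal B ->
      same_ideal J (fun f => A f /\ B f) -> same_ideal J A \/ same_ideal J B].

(* No component contains the intersection of the others, and the radicals
   (associated primes) of the components are pairwise distinct. *)
Definition irredundant_primary_decomposition (m : nat) J
    (Q : 'I_m -> R -> Prop) : Prop :=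
  [/\ forall i, primary_ideal (Q i),
      same_ideal J (fun f => forall i, Q i f),
      forall i, ~ (forall f, (forall i', i' != i -> Q i' f) -> Q i f) &
      forall i i', same_ideal (radical (Q i)) (radical (Q i')) -> i = i'].

End Ideals.

Section PolynomialMaps.

Variable R : comNzRingType.
Implicit Types (a b p : 'rV[R]_3) (s q : seq 'rV[R]_3).

(* Coordinates are indexed by 0, 1, 2 in 'I_3, and c + 1, c + 2 are mod 3. *)
Definition cross a b : 'rV[R]_3 :=
  \row_c (a 0 (c + 1) * b 0 (c + 2) - a 0 (c + 2) * b 0 (c + 1)).

Definition diagS a : 'rV[R]_3 :=
  \row_c (if c == ord_max then a 0 c else - a 0 c).

(* A point (v_1, ..., v_j) of 3j-dimensional affine space is a sequence of j
   triples; w [:: v_1; ...; v_j] is w_j (junk value 0 for j < 2). *)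
Definition w s : 'rV[R]_3 :=
  match s with
  | v1 :: v2 :: s' => foldl (fun u v => cross (diagS u) v) (cross v1 v2) s'
  | _ => 0
  end.

Lemma w_pair v1 v2 : w [:: v1; v2] = cross v1 v2.
Proof. by []. Qed.

Lemma w_rcons s v : (2 <= size s)%N -> w (rcons s v) = cross (diagS (w s)) v.
Proof. by case: s => [|v1 [|v2 s]] //= _; rewrite -cats1 foldl_cat. Qed.

(* Phi_j is Phi on sequences of length j - 1; the singleton case is Phi_2. *)
Definition Phi s (lam : R) : seq 'rV[R]_3 :=
  if s is [:: p] then [:: p; lam *: p] else rcons s (lam *: diagS (w s)).

Definition Psi s (lam : R) q : seq 'rV[R]_3 := Phi s lam ++ q.

End PolynomialMaps.

Section Components.

Variable F : fieldType.

(* The n triples of variables selected by e among the N variables. *)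
Definition vars (N n : nat) (e : 'I_(n * 3) -> 'I_N) : seq 'rV[{mpoly F[N]}]_3 :=
  [seq \row_c 'X_(e (mxvec_index i c)) | i <- enum 'I_n].

(* In {mpoly F[k * 3]} the variable v_(i+1, c+1) is 'X_(mxvec_index i c). *)
Definition ideal_I (k : nat) : {mpoly F[k * 3]} -> Prop := fun f =>
  exists h : 'I_3 -> {mpoly F[k * 3]}, f = \sum_c h c * w (vars (@id 'I_(k * 3))) 0 c.

(* The variables of the target ring are, in this order, the (j - 1) * 3
   coordinates of p, then lambda, then the (k - j) * 3 coordinates of q. *)
Definition psi_point (k j : nat)
    : seq 'rV[{mpoly F[j.-1 * 3 + 1 + (k - j) * 3]}]_3 :=
  Psi (vars (fun l : 'I_(j.-1 * 3) => lshift _ (lshift 1 l)))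
      'X_(lshift _ (rshift _ ord0))
      (vars (fun l : 'I_((k - j) * 3) => rshift _ l)).

Definition phi (k j : nat) (f : {mpoly F[k * 3]})
    : {mpoly F[j.-1 * 3 + 1 + (k - j) * 3]} :=
  f \mPo [tuple mxvec (\matrix_(i < k, c < 3) nth 0 (psi_point k j) i 0 c) 0 l
         | l < k * 3].

Lemma phi_var (k j : nat) (i : 'I_k) (c : 'I_3) :
  phi j 'X_(mxvec_index i c) = nth 0 (psi_point k j) i 0 c.
Proof. by rewrite /phi comp_mpolyXU -tnth_nth tnth_mktuple mxvecE mxE. Qed.

Lemma size_psi_point (k j : nat) :
  (2 <= j <= k)%N -> size (psi_point k j) = k.
Proof.
case/andP=> j2 jk; rewrite /psi_point /Psi size_cat {2}/vars size_map size_enum_ord.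
have szPhi (R : comNzRingType) (s : seq 'rV[R]_3) (x : R) :
  size (Phi s x) = (size s).+1 by case: s => [|a [|b s]] //=; rewrite size_rcons.
rewrite szPhi size_map size_enum_ord prednK ?subnKC //.
exact: leq_trans j2.
Qed.

Definition ideal_P (k j : nat) : {mpoly F[k * 3]} -> Prop :=
  fun f => phi j f = 0.

End Components.

Arguments ideal_I F k f : clear implicits.
Arguments ideal_P F k j f : clear implicits.

(* Main.v *)
Require Import Defs.
From Stdlib Require Import Classical.
From mathcomp Require Import all_boot all_order all_algebra.
From mathcomp Require Import mpoly.
From mathcomp Require Import ring zify.

(** Let S = diag(-1,-1,1).  As S is an involution and respects cross products,
the rows V_0 = v_1 and V_n = S^(n-1) v_(n+1), whose entries are the variables up
to sign, satisfy w_(n+1) = S^(n-1) x_n for the plain iterated product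
x_0 = V_0, x_(n+1) = x_n x V_(n+1).  So I_k is generated by the entries of
x_(k-1), and P_(n+2), written P n below, is the kernel of a homomorphism which
makes V_(n+1) a multiple of x_n and leaves the other rows generic.

Being the kernel of a map into a domain, P n is prime.  It contains the entries
of x_(n+1) = x_n x V_(n+1), and modulo these u_0 V_(n+1) is V_(n+1),0 u, where
u = x_n; hence every element of P n falls into the ideal (x_(n+1)) after
multiplication by a power of u_0 (P_power).  Equations for P n follow by
cancelling u_0, which is regular modulo suitable ideals:
  - P 0 is generated by the entries of x_1 (P_minors);
  - for n > 0, with a = x_(n-1), b = V_n and y = V_(n+1), so that
    x_(n+1) = (a x b) x y = (a.y) b - (b.y) a, every element of P n is a
    combination of alpha = a.y and beta = b.y (P_linear).
All regularity statements come from two facts.  If c is regular modulo an ideal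
J, then so is c X + d, for a variable X occurring neither in c and d nor in the
generators of J (regular_linear).  If x is regular modulo J and z is regular
modulo J + (x), then x is regular modulo J + (z) (regular_swap).

That P 0, ..., P n intersect in (x_(n+1)) is shown by induction on n
(chain_inter).  Let f be in the intersection, f = alpha g + beta h with
a, b, y as above.  By induction f lies in (a x b), hence in (a); so does alpha,
and beta is regular modulo (a), so h lies in (a).  Since a_i beta = b_i alpha
modulo (x_(n+1)), we may take h = 0.  Now alpha g lies in the prime P (n-1),
which does not contain alpha, so g is in P (n-1).  Finally alpha P (n-1) is
contained in (x_(n+1)), by the equations for P (n-1) (alpha_P).

The primes are incomparable (P_separated): for i < j the entries of x_(i+1) lie
in P i but not in P j, while V_j . V_(j+1) lies in P j but not in P i.  A finite
intersection of pairwise incomparable primes is an irredundant primary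
decomposition, and it is the only one, because all its components are isolated
(prime_decomposition_unique). *)

Set Implicit Arguments.
Unset Strict Implicit.
Unset Printing Implicit Defensive.

Import GRing.Theory.
Local Open Scope ring_scope.
Local Notation "x %:F" := (@FracField.tofrac _ x).

(** * Finitely generated ideals and regular elements *)

Section Span.

Variable R : comNzRingType.
Implicit Types (s : seq R) (f g h x z : R).

Fixpoint ideal_span s f : Prop :=
  if s is g :: s' then exists h, ideal_span s' (f - h * g) else f = 0.

Lemma span_ideal s : is_ideal (ideal_span s).
Proof.
elim: s => [|g s [s0 sD]] /=; split=> //.
- by move=> a f h -> ->; rewrite mulr0 addr0.
- by exists 0; rewrite mul0r subr0.
move=> a f1 f2 [h1 sf1] [h2 sf2]; exists (a * h1 + h2).
have -> : a * f1 + f2 - (a * h1 + h2) * g = a * (f1 - h1 * g) + (f2 - h2 * g).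
  by ring.
exact: sD.
Qed.

Lemma span0 s : ideal_span s 0. Proof. by case: (span_ideal s). Qed.

Lemma span_lin s a f g : ideal_span s f -> ideal_span s g -> ideal_span s (a * f + g).
Proof. by case: (span_ideal s) => _; apply. Qed.

Lemma span_mull s a f : ideal_span s f -> ideal_span s (a * f).
Proof. by move=> sf; rewrite -[_ * _]addr0; apply: span_lin => //; apply: span0. Qed.

Lemma span_add s f g : ideal_span s f -> ideal_span s g -> ideal_span s (f + g).
Proof. by move=> sf; rewrite -[f]mul1r; apply: span_lin. Qed.

Lemma span_sub s f g : ideal_span s f -> ideal_span s g -> ideal_span s (f - g).
Proof. by move=> sf sg; rewrite addrC -mulN1r; apply: span_lin. Qed.

Lemma span_cons s g f : ideal_span s f -> ideal_span (g :: s) f.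
Proof. by exists 0; rewrite mul0r subr0. Qed.

Lemma span_mem s g : g \in s -> ideal_span s g.
Proof.
elim: s => //= h s IHs; rewrite inE => /predU1P[->|/IHs sg].
  by exists 1; rewrite mul1r subrr; apply: span0.
exact: span_cons.
Qed.

Lemma span_least s (J : R -> Prop) f : is_ideal J ->
  {in s, forall g, J g} -> ideal_span s f -> J f.
Proof.
move=> [J0 JD]; elim: s f => [|g s IHs] f sJ /=; first by move->.
case=> h sf; rewrite -(subrK (h * g) f) addrC.
apply: JD; first by apply: sJ; rewrite mem_head.
by apply: IHs => // x xs; apply: sJ; rewrite inE xs orbT.
Qed.

Lemma span_perm s t f : {subset s <= t} -> ideal_span s f -> ideal_span t f.
Proof. by move=> sub; apply: span_least (span_ideal t) _ => g /sub/span_mem. Qed.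

Lemma span1P g f : ideal_span [:: g] f <-> exists h, f = h * g.
Proof.
by split=> -[h]; [move/eqP; rewrite subr_eq0 => /eqP | move->]; exists h; rewrite ?subrr.
Qed.

Lemma span2P g0 g1 f :
  ideal_span [:: g0; g1] f <-> exists h0 h1, f = h0 * g0 + h1 * g1.
Proof.
split=> [[h0 /span1P[h1 /eqP]]|[h0 [h1 ->]]].
  by rewrite subr_eq addrC => /eqP; exists h0, h1.
by exists h0; apply/span1P; exists h1; rewrite addrC addKr.
Qed.

Lemma span3P g0 g1 g2 f : ideal_span [:: g0; g1; g2] f <->
  exists h0 h1 h2, f = h0 * g0 + h1 * g1 + h2 * g2.
Proof.
split=> [[h0 /span2P[h1 [h2 /eqP]]]|[h0 [h1 [h2 ->]]]].
  by rewrite subr_eq addrC addrA => /eqP; exists h0, h1, h2.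
by exists h0; apply/span2P; exists h1, h2; ring.
Qed.

Definition regular s x : Prop := forall f, ideal_span s (x * f) -> ideal_span s f.

Lemma regularN s x : regular s x -> regular s (- x).
Proof. by move=> rx f; rewrite mulNr -mulrN => /rx/(span_mull (-1)); rewrite mulN1r opprK. Qed.

Lemma regular_perm s t x : {subset s <= t} -> {subset t <= s} ->
  regular s x -> regular t x.
Proof. by move=> st ts rx f /(span_perm ts)/rx/(span_perm st). Qed.

Lemma regularXn s x n f : regular s x -> ideal_span s (x ^+ n * f) -> ideal_span s f.
Proof. by move=> rx; elim: n => [|n IHn]; rewrite ?mul1r // exprS -mulrA => /rx. Qed.

Lemma regular_neq0 x : regular [::] x -> x != 0.
Proof.
move=> rx; apply/eqP => x0; have /= := rx 1.
by rewrite x0 mul0r => /(_ erefl)/eqP; rewrite oner_eq0.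
Qed.

(** If x f = z g modulo s, then g = x g' modulo s by regularity of z, and x cancels
from x (f - z g'). *)
Lemma regular_swap s x z : regular s x -> regular (x :: s) z -> regular (z :: s) x.
Proof.
move=> rx rz f [g sxfg].
have [g' sg'] : ideal_span (x :: s) g.
  apply: rz; exists f.
  have -> : z * g - f * x = -1 * (x * f - g * z) + 0 by ring.
  by apply: span_lin; last exact: span0.
exists g'; apply: rx.
have -> : x * (f - g' * z) = z * (g - g' * x) + (x * f - g * z) by ring.
exact: span_lin.
Qed.

End Span.

(** Let X be one of the variables of a polynomial ring R.  The substitution of a
fresh variable for X is a homomorphism R -> R[T] that is undone by evaluation
at X; the elements in which X does not occur are those sent to constants.  In
this form, several variables of the same ring can be treated alike, without
viewing R as an iterated polynomial ring. *)
Section Linear.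

Variables (R : comNzRingType) (X : R) (psi : {rmorphism R -> {poly R}}).
Hypothesis psiX : psi X = 'X.
Hypothesis psiK : forall f, (psi f).[X] = f.

Definition free_of c := psi c = c%:P.

Lemma freeD a b : free_of a -> free_of b -> free_of (a + b).
Proof. by rewrite /free_of rmorphD polyCD => -> ->. Qed.
Lemma freeN a : free_of a -> free_of (- a).
Proof. by rewrite /free_of rmorphN polyCN => ->. Qed.
Lemma freeM a b : free_of a -> free_of b -> free_of (a * b).
Proof. by rewrite /free_of rmorphM polyCM => -> ->. Qed.

(** Generators free of X survive the substitution as constants, so membership can
be tested coefficient by coefficient. *)
Lemma span_coef s f i : {in s, forall g, free_of g} -> ideal_span s f -> ideal_span s (psi f)`_i.
Proof.
elim: s f => [|g s IHs] f frs /=; first by move->; rewrite rmorph0 coef0.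
case=> h sf; exists (psi h)`_i.
rewrite -coefMC -coefB -(frs g) ?mem_head // -rmorphM -rmorphB.
by apply: IHs => // x xs; apply: frs; rewrite inE xs orbT.
Qed.

(** The coefficients of a multiplier f of [c * X + d] are reached from the top one
downwards, each through the coefficient [c * p_i + d * p_(i+1)] of the product. *)
Lemma regular_linear s c d : {in s, forall g, free_of g} -> free_of c -> free_of d ->
  regular s c -> regular s (c * X + d).
Proof.
move=> frs frc frd rc f sf.
set p := psi f.
have sp i : ideal_span s (c * p`_i + d * p`_i.+1).
  have := span_coef i.+1 frs sf.
  rewrite rmorphM rmorphD rmorphM frc frd psiX mulrDl coefD coefCM.
  by rewrite -mulrA coefCM coefXM.
have {}sp n i : (size p <= i + n)%N -> ideal_span s p`_i.
  elim: n i => [|n IHn] i.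
    by rewrite addn0 => /(nth_default 0)->; apply: span0.
  rewrite addnS -addSn => /IHn sp1; apply: rc.
  have -> : c * p`_i = - d * p`_i.+1 + (c * p`_i + d * p`_i.+1) by ring.
  exact: span_lin.
rewrite -(psiK f) horner_coef; elim/big_rec: _ => [|i g _ sg]; first exact: span0.
by rewrite mulrC; apply: span_lin => //; apply: (sp (size p)); rewrite leq_addl.
Qed.

Lemma regular_var s : {in s, forall g, free_of g} -> regular s X.
Proof.
move=> frs; rewrite -[X]mul1r -[_ * X]addr0; apply: regular_linear => //.
- by rewrite /free_of rmorph1.
- by rewrite /free_of rmorph0.
- by move=> f; rewrite mul1r.
Qed.

End Linear.

(** * Primary decompositions into incomparable primes *)

Section Primes.

Variable R : comNzRingType.
Implicit Types (J : R -> Prop).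

Lemma ideal_mull J a f : is_ideal J -> J f -> J (a * f).
Proof. by case=> J0 JD Jf; rewrite -[_ * _]addr0; apply: JD. Qed.

Lemma prime_exp J f n : prime_ideal J -> J (f ^+ n) -> J f.
Proof.
by case=> _ J1 JM; elim: n => [|n IHn]; [move/J1 | rewrite exprS => /JM[]].
Qed.

Lemma radical_prime J : prime_ideal J -> same_ideal (radical J) J.
Proof. by move=> pJ f; split=> [[n /(prime_exp pJ)] | Jf] //; exists 1%N. Qed.

Lemma prime_primary J : prime_ideal J -> primary_ideal J.
Proof.
move=> pJ; have [idJ J1 JM] := pJ; split=> // f g /JM[]; first by left.
by right; exists 1%N.
Qed.

Lemma prime_radical J : prime_ideal J -> radical_ideal J.
Proof. by move=> pJ; split; [case: pJ | apply: radical_prime]. Qed.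

(** If J is the intersection of A and B, and a in A is not in J, then a B lies in
J, whence B does. *)
Lemma prime_irreducible J : prime_ideal J -> irreducible_ideal J.
Proof.
case=> idJ J1 JM; split=> // A B idA idB JAB.
have [AJ|] := classic (forall f, A f -> J f); first by left=> f; split=> [/JAB[]|/AJ].
move=> nAJ; have [a naJ] := not_all_ex_not _ _ nAJ.
have [Aa Ja] := imply_to_and _ _ naJ; right=> b; split=> [/JAB[]//|Bb].
have : J (a * b) by apply/JAB; split; [rewrite mulrC|]; apply: ideal_mull.
by case/JM.
Qed.

(** The witness is the product of one witness for each [i]: it lies in every [Q i],
and outside the prime [J]. *)
Lemma prime_avoid J n (C : pred 'I_n) (Q : 'I_n -> R -> Prop) :
    prime_ideal J -> (forall i, C i -> is_ideal (Q i)) ->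
    (forall i, C i -> exists2 g, Q i g & ~ J g) ->
  exists2 g, (forall i, C i -> Q i g) & ~ J g.
Proof.
move=> [_ J1 JM] idQ ex.
have [g gP] : exists g : 'I_n -> R, forall i, (C i -> Q i (g i)) /\ ~ J (g i).
  apply: (@fin_all_exists _ (fun=> R) (fun i u => (C i -> Q i u) /\ ~ J u)) => i.
  by case: (boolP (C i)) => [/ex[u Qu Ju]|_]; [exists u | exists 1].
exists (\prod_i g i) => [i Ci|].
  rewrite (bigD1 i) //= mulrC; apply: ideal_mull; first exact: idQ.
  by case: (gP i) => /(_ Ci).
by elim/big_rec: _ => [//|i f _ Jf] /JM[]//; case: (gP i).
Qed.

Lemma prime_contains J n (Q : 'I_n -> R -> Prop) :
    prime_ideal J -> (forall i, is_ideal (Q i)) ->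
    (forall f, (forall i, Q i f) -> J f) ->
  exists i, forall f, Q i f -> J f.
Proof.
move=> pJ idQ QJ; apply: NNPP => nQ.
have [i _|i _|g Qg] := @prime_avoid J n predT Q pJ.
- exact: idQ.
- apply: NNPP => ng; apply: nQ; exists i => f Qf.
  by apply: NNPP => Jf; apply: ng; exists f.
- by apply; apply: QJ => i; apply: Qg.
Qed.

(** Closure under sums is the binomial argument: every term of the expansion of
the power [n + m] has a factor f^n or g^m. *)
Lemma primary_radical_prime J : primary_ideal J -> prime_ideal (radical J).
Proof.
case=> idJ J1 JM; have [J0 JD] := idJ; split.
- split; first by exists 1%N; rewrite expr1.
  move=> a f g [n Jf] [m Jg]; exists (n + m)%N.
  rewrite exprDn; elim/big_rec: _ => // i s _ Js.
  rewrite -mulr_natr; set c := _%:R.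
  have [ni|ni] := leqP n (n + m - i).
    have -> : (a * f) ^+ (n + m - i) * g ^+ i * c =
       (a ^+ (n + m - i) * f ^+ (n + m - i - n) * g ^+ i * c) * f ^+ n.
      have -> : (a * f) ^+ (n + m - i) =
          a ^+ (n + m - i) * (f ^+ (n + m - i - n) * f ^+ n).
        by rewrite exprMn -exprD subnK.
      by ring.
    exact: JD.
  have -> : (a * f) ^+ (n + m - i) * g ^+ i * c =
     ((a * f) ^+ (n + m - i) * g ^+ (i - m) * c) * g ^+ m.
    have -> : g ^+ i = g ^+ (i - m) * g ^+ m by rewrite -exprD subnK //; lia.
    by ring.
  exact: JD.
- by case=> n; rewrite expr1n.
- move=> f g [n]; rewrite exprMn => /JM[Jf|[m]]; first by left; exists n.
  by rewrite -exprM => Jg; right; exists (n * m)%N.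
Qed.

Variables (m : nat) (I : R -> Prop) (P : 'I_m -> R -> Prop).
Hypothesis prime_P : forall i, prime_ideal (P i).
Hypothesis inter_eq : same_ideal I (fun f => forall i, P i f).
Hypothesis incomparable : forall i j, i != j -> exists2 g, P j g & ~ P i g.

Let P_is_ideal i : is_ideal (P i). Proof. by case: (prime_P i). Qed.

Lemma avoid_others j : exists2 g, (forall i, i != j -> P i g) & ~ P j g.
Proof.
apply: prime_avoid => // i.
by rewrite eq_sym => /incomparable.
Qed.

Lemma prime_decomposition : irredundant_primary_decomposition I P.
Proof.
split=> // [i|i PP|i j PP]; first exact: prime_primary.
  by have [g Pg] := avoid_others i; apply; apply: PP.
apply/eqP/negPn/negP => /incomparable[g Pg]; apply.
by apply/(radical_prime (prime_P i))/PP; exists 1%N.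
Qed.

(** For each [j] the intersection of the [Q i] is contained in the prime [P j],
hence so is some [Q i], and the radical of that [Q i], a prime containing the
intersection of the [P j'], contains some [P j'].  Incomparability forces
j' = j, so the radical of [Q i] is [P j]; and [Q i] is [P j] itself, because
[P j] times an element outside [P j] and inside the other primes lies in I,
hence in the primary ideal [Q i].  Irredundancy leaves no further component. *)
Lemma prime_decomposition_unique n (Q : 'I_n -> R -> Prop) :
  irredundant_primary_decomposition I Q ->
  n = m /\ exists sigma : 'I_n -> 'I_m, bijective sigma /\
    forall i, same_ideal (Q i) (P (sigma i)).
Proof.
case=> prim_Q inter_Q irr_Q _.
have ideal_Q i : is_ideal (Q i) by case: (prim_Q i).
have rad_Q i f : Q i f -> radical (Q i) f by exists 1%N.
have [tau tauP] : exists tau : 'I_m -> 'I_n, forall j, same_ideal (Q (tau j)) (P j).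
  apply: (@fin_all_exists _ (fun=> 'I_n) (fun j i => same_ideal (Q i) (P j))) => j.
  have [|i Qi] := prime_contains (prime_P j) ideal_Q.
    by move=> f /inter_Q/inter_eq.
  have rad_QP f : radical (Q i) f -> P j f.
    by case=> r /Qi/(prime_exp (prime_P j)).
  have [|j' Pj'] := prime_contains (primary_radical_prime (prim_Q i)) P_is_ideal.
    by move=> f /inter_eq/inter_Q Qf; apply: rad_Q.
  have jj' : j = j'.
    by apply/eqP/negPn/negP => /incomparable[g Pg]; apply; apply/rad_QP/Pj'.
  exists i => f; split=> [/Qi//|Pf].
  have [g Pg Pjg] := avoid_others j.
  have : I (f * g).
    apply/inter_eq => j0; have [->|nj] := eqVneq j0 j.
      by rewrite mulrC; apply: ideal_mull.
    by apply: ideal_mull (Pg _ nj).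
  move/inter_Q/(_ i); have [_ _ QM] := prim_Q i.
  by case/QM => // /rad_QP.
have tau_inj : injective tau.
  move=> j j' tjj'; apply/eqP/negPn/negP => /incomparable[g Pg]; apply.
  by apply/tauP; rewrite tjj'; apply/tauP.
have tau_surj i : exists j, tau j = i.
  apply: NNPP => nj; apply: (irr_Q i) => f Qf.
  suff /inter_Q : I f by apply.
  apply/inter_eq => j; apply/tauP/Qf; apply/eqP => tj.
  by apply: nj; exists j.
have [sigma sigmaK] : exists sigma : 'I_n -> 'I_m, forall i, tau (sigma i) = i.
  exact: (@fin_all_exists _ (fun=> 'I_m) (fun i j => tau j = i)).
have tauK : cancel tau sigma by move=> j; apply: tau_inj.
split.
  by rewrite -[n]card_ord -[m]card_ord; apply: (@bij_eq_card _ _ sigma); exists tau.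
exists sigma; split; first by exists tau.
by move=> i; rewrite -{1}[i]sigmaK.
Qed.

End Primes.

(** * Iterated cross products of generic rows *)

Fact I3_12 : 1 + 2 = 0 :> 'I_3. Proof. exact: val_inj. Qed.
Fact I3_21 : 2 + 1 = 0 :> 'I_3. Proof. exact: val_inj. Qed.
Fact I3_22 : 2 + 2 = 1 :> 'I_3. Proof. exact: val_inj. Qed.

Fact I3_enum (c : 'I_3) : c \in [:: 0; 1; 2].
Proof. by case: c => -[|[|[|//]]]. Qed.

Section Cross.

Variable R : comNzRingType.
Implicit Types (a b : 'rV[R]_3).

Definition dot a b : R := a 0 0 * b 0 0 + a 0 1 * b 0 1 + a 0 2 * b 0 2.

Definition coords a : seq R := [:: a 0 0; a 0 1; a 0 2].

Lemma cross0 a b : cross a b 0 0 = a 0 1 * b 0 2 - a 0 2 * b 0 1.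
Proof. by rewrite mxE !add0r. Qed.
Lemma cross1 a b : cross a b 0 1 = a 0 2 * b 0 0 - a 0 0 * b 0 2.
Proof. by rewrite mxE I3_12. Qed.
Lemma cross2 a b : cross a b 0 2 = a 0 0 * b 0 1 - a 0 1 * b 0 0.
Proof. by rewrite mxE I3_21 I3_22. Qed.
Definition crossE := (cross0, cross1, cross2).

Lemma coordsP a c : a 0 c \in coords a.
Proof.
by have := I3_enum c; rewrite !inE => /or3P[]/eqP->; rewrite eqxx ?orbT.
Qed.

Lemma coords_all (J : R -> Prop) a :
  (forall c, J (a 0 c)) -> {in coords a, forall g, J g}.
Proof. by move=> Ja g; rewrite !inE => /or3P[]/eqP->. Qed.

Lemma span_coords a f : ideal_span (coords a) f <->
  exists h : 'rV[R]_3, f = dot h a.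
Proof.
split=> [/span3P[h0 [h1 [h2 ->]]]|[h ->]].
  exists (\row_c (if c == 0 then h0 else if c == 1 then h1 else h2)).
  by rewrite /dot !mxE.
by apply/span3P; exists (h 0 0), (h 0 1), (h 0 2).
Qed.

Lemma span_sum a f : ideal_span (coords a) f <->
  exists h : 'I_3 -> R, f = \sum_c h c * a 0 c.
Proof.
have sumE (h : 'I_3 -> R) : \sum_c h c * a 0 c = h 0 * a 0 0 + h 1 * a 0 1 + h 2 * a 0 2.
  rewrite !big_ord_recl big_ord0 addr0 addrA.
  have -> : lift ord0 ord0 = 1 :> 'I_3 by apply: val_inj.
  by have -> : lift ord0 (lift ord0 ord0) = 2 :> 'I_3 by apply: val_inj.
rewrite span_coords; split=> [[h ->]|[h ->]]; first by exists (h 0); rewrite sumE.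
by exists (\row_c h c); rewrite sumE /dot !mxE.
Qed.

Fact eq_by_sub (A B X Y : R) : A = B -> X - Y = A - B -> X = Y.
Proof. by move=> -> /eqP; rewrite subrr subr_eq0 => /eqP. Qed.

(** The ideal of the 2 x 2 minors of the matrix with columns [a] and [y] is not a
complete intersection, so [regular_swap] does not apply.  If a_0 f is a
combination of the minors with coefficients h, then modulo a_0 the relation
forces h to be a combination t y + r a; since y and a are orthogonal to
a x y, only the remaining part of h, a multiple of a_0, contributes to a_0 f,
and a_0 cancels. *)
Lemma regular_cross a (y : 'rV[R]_3) :
    regular [::] (a 0 0) -> regular [:: a 0 0] (a 0 1) ->
    regular [:: a 0 0; a 0 1] (a 0 2) -> regular [:: a 0 0] (y 0 0) ->
    regular [:: a 0 0; y 0 0] (a 0 1 * y 0 2 - a 0 2 * y 0 1) ->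
  regular (coords (cross a y)) (a 0 0).
Proof.
rewrite /coords !crossE.
move: (a 0 0) (a 0 1) (a 0 2) (y 0 0) (y 0 1) (y 0 2) => a0 a1 a2 y0 y1 y2.
move=> ra0 ra1 ra2 ry0 ru f /span3P[h0 [h1 [h2 E]]].
(* The three coefficients are found in turn:
   h_0 = s a_0 + t y_0, h_1 = t y_1 + r a_1 + s' a_0, h_2 = t y_2 + r a_2 + s'' a_0. *)
have /span2P[s [t h0E]] : ideal_span [:: a0; y0] h0.
  apply: ru; apply/span2P; exists (f + h1 * y2 - h2 * y1), (h2 * a1 - h1 * a2).
  by apply: (eq_by_sub (esym E)); ring.
have /span1P[z zE] : ideal_span [:: a0] ((h1 - t * y1) * a2 - (h2 - t * y2) * a1).
  apply: ry0; apply/span1P; exists (f + h1 * y2 - h2 * y1 - s * (a1 * y2 - a2 * y1)).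
  by apply: (eq_by_sub (esym E)); rewrite h0E; ring.
have /span2P[s' [r h1E]] : ideal_span [:: a0; a1] (h1 - t * y1).
  by apply: ra2; apply/span2P; exists z, (h2 - t * y2); apply: (eq_by_sub zE); ring.
have /span1P[s'' h2E] : ideal_span [:: a0] (h2 - t * y2 - r * a2).
  apply: ra1; apply/span1P; exists (s' * a2 - z).
  by apply: (eq_by_sub (esym zE)); rewrite h1E; ring.
apply/span3P; exists (s - r), s', s''; apply/eqP; rewrite -subr_eq0; apply/eqP.
apply: ra0 => /=.
move/eqP: h1E; rewrite subr_eq => /eqP h1E.
move/eqP: h2E; rewrite subr_eq => /eqP/esym/eqP; rewrite -subr_eq => /eqP h2E.
by rewrite mulrBr E h0E h1E -h2E; ring.
Qed.

Fixpoint chain (V : nat -> 'rV[R]_3) n : 'rV[R]_3 :=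
  if n is m.+1 then cross (chain V m) (V n) else V 0.

End Cross.

(** The hypotheses describe a polynomial ring in the entries of the rows
V_0, ..., V_(k-1): [psi n c] substitutes a fresh variable for the entry [c] of
V_n.  The rows are generic rather than the variables themselves, so that signs
can be absorbed in them. *)
Section Chain.

Variables (R : idomainType) (k : nat) (V : nat -> 'rV[R]_3).
Variable psi : nat -> 'I_3 -> {rmorphism R -> {poly R}}.
Hypothesis psiK : forall n c f, (n < k)%N -> (psi n c f).[V n 0 c] = f.
Hypothesis psiV : forall n c, (n < k)%N -> psi n c (V n 0 c) = 'X.
Hypothesis psi_other : forall n c n' c', (n < k)%N -> (n, c) != (n', c') ->
  psi n c (V n' 0 c') = (V n' 0 c')%:P.

Notation x := (chain V).

Lemma chain_free n c m c' : (m < n < k)%N -> free_of (psi n c) (x m 0 c').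
Proof.
elim: m c' => [|m IHm] c' /andP[mn nk].
  by apply: psi_other => //; apply: contraTneq mn => -[-> _]; rewrite ltnn.
have fV i : free_of (psi n c) (V m.+1 0 i).
  by apply: psi_other => //; apply: contraTneq mn => -[-> _]; rewrite ltnn.
have fx i : free_of (psi n c) (x m 0 i) by apply: IHm; rewrite (ltnW mn).
by rewrite mxE; apply/freeD/freeN/freeM => //; apply: freeM.
Qed.

(* The last alternative handles two entries of the same row; it leaves their
   positions to be compared. *)
Ltac solve_free := repeat first
  [ by apply: chain_free; lia
  | apply: freeD | apply: freeN | apply: freeM
  | by apply: psi_other; [lia | rewrite xpair_eqE; apply/negP => /andP[/eqP]; lia]
  | apply: psi_other; [lia | rewrite xpair_eqE eqxx /=] ].

Lemma regularL n c s e d : (n < k)%N -> {in s, forall g, free_of (psi n c) g} ->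
  free_of (psi n c) e -> free_of (psi n c) d -> regular s e ->
  regular s (e * V n 0 c + d).
Proof. by move=> nk; apply: regular_linear => [|f]; [apply: psiV | apply: psiK]. Qed.

Lemma regularV n c s : (n < k)%N -> {in s, forall g, free_of (psi n c) g} ->
  regular s (V n 0 c).
Proof. by move=> nk; apply: regular_var => [|f]; [apply: psiV | apply: psiK]. Qed.

(** Two entries of x_n form a regular sequence.  For x_(n+1) = a x b the entry
[c + 1] is linear in b_c with coefficient a_(c+2), so it suffices that a_(c+2)
is regular modulo the entry [c], which is linear in b_(c+2) with coefficient
a_(c+1); the two entries of a are exchanged by [regular_swap]. *)
Lemma chain_regular n c : (n < k)%N ->
  regular [::] (x n 0 c) /\ regular [:: x n 0 c] (x n 0 (c + 1)).
Proof.
have c1 (i : 'I_3) : i + 1 != i by case: i => -[|[|[|//]]].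
have c2 (i : 'I_3) : i + 2 != i by case: i => -[|[|[|//]]].
have c12 (i : 'I_3) : i + 1 != i + 2 by case: i => -[|[|[|//]]].
elim: n c => [|n IHn] c nk.
  split; first exact: regularV.
  apply: regularV => // g; rewrite inE => /eqP->.
  by apply: psi_other; rewrite // xpair_eqE /= c1.
have c112 : c + 1 + 1 = c + 2 by rewrite -addrA.
have c121 : c + 1 + 2 = c by apply: val_inj; case: (c) => -[|[|[|//]]].
have c22 : c + 2 + 1 = c by apply: val_inj; case: (c) => -[|[|[|//]]].
have nk' := ltnW nk.
have [a1 a1a2] := IHn (c + 1) nk'.
have [a2 a2a0] := IHn (c + 2) nk'.
rewrite c112 in a1a2.
have pE : x n.+1 0 c = x n 0 (c + 1) * V n.+1 0 (c + 2) +
            - (x n 0 (c + 2) * V n.+1 0 (c + 1)) by rewrite mxE.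
split.
  by rewrite pE; apply: regularL => //; solve_free; rewrite eq_sym.
have -> : x n.+1 0 (c + 1) = x n 0 (c + 2) * V n.+1 0 c +
            - (x n 0 c * V n.+1 0 (c + 2)) by rewrite mxE c112 c121.
apply: regularL => //; solve_free.
- by move=> g; rewrite inE => /eqP->; rewrite pE; solve_free; rewrite // eq_sym.
- by rewrite eq_sym.
apply: regular_swap => //; rewrite pE; apply: regularL => //; solve_free.
- by move=> g; rewrite inE => /eqP->; solve_free.
- by rewrite eq_sym.
- exact: regular_swap.
Qed.

(** * Equations and intersections of the prime components *)

(** Over the fraction field, [chi n] moves V_(n+1) to the multiple of x_n with the
same entry 0, and fixes the other rows; as it vanishes on [P n], an element of
[P n] fixed by it is zero.  In [gen], the scalars appear only as elements fixed
by every [chi n]. *)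
Variables (chi : nat -> {rmorphism R -> {fraction R}}) (P : nat -> R -> Prop).
Hypothesis gen : forall Q : R -> Prop,
  (forall f, (forall n, chi n f = f%:F) -> Q f) ->
  (forall f g, Q f -> Q g -> Q (f + g)) ->
  (forall f g, Q f -> Q g -> Q (f * g)) ->
  (forall n c, Q (V n 0 c)) -> forall f, Q f.
Hypothesis chi_other : forall n m c, (n.+1 < k)%N -> m != n.+1 ->
  chi n (V m 0 c) = (V m 0 c)%:F.
Hypothesis chi_V : forall n c, (n.+1 < k)%N ->
  (x n 0 0)%:F * chi n (V n.+1 0 c) = (V n.+1 0 0)%:F * (x n 0 c)%:F.
Hypothesis P_prime : forall n, (n.+1 < k)%N -> prime_ideal (P n).
Hypothesis P_chain : forall n c, (n.+1 < k)%N -> P n (x n.+1 0 c).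
Hypothesis P_chi : forall n f, (n.+1 < k)%N -> P n f -> chi n f = 0.

Lemma P_ideal n : (n.+1 < k)%N -> is_ideal (P n).
Proof. by case/P_prime. Qed.

Lemma chi_chain n m c : (m <= n)%N -> (n.+1 < k)%N ->
  chi n (x m 0 c) = (x m 0 c)%:F.
Proof.
elim: m c => [|m IHm] c mn nk; first exact: chi_other.
rewrite mxE rmorphB !rmorphM !IHm ?(ltnW mn) // !chi_other ?tofracB ?tofracM //;
  by rewrite eqSS; apply: contraTneq mn => ->; rewrite ltnn.
Qed.

Lemma P_fixed n f : (n.+1 < k)%N -> chi n f = f%:F -> P n f -> f = 0.
Proof.
move=> nk fE /(P_chi nk)/eqP; rewrite fE -tofrac0 tofrac_eq => /eqP //.
Qed.

(** Modulo the entries of x_(n+1), the entries of u_0 V_(n+1) are V_(n+1),0 u_c;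
so multiplication by a power of u_0 eliminates every entry of V_(n+1) but the
first.  The result r is recorded through its image under [chi n], which avoids
speaking of the subring in which r lies. *)
Lemma chi_elimination n f : (n.+1 < k)%N -> exists N r,
  ideal_span (coords (x n.+1)) (x n 0 0 ^+ N * f - r) /\ (x n 0 0)%:F ^+ N * chi n f = r%:F.
Proof.
move=> nk; set u := x n; set s := coords _.
elim/gen: f => [f fE|f g [N [r [sf fE]]] [M [q [sg gE]]]
               |f g [N [r [sf fE]]] [M [q [sg gE]]]|m c].
- by exists 0%N, f; rewrite !expr0 !mul1r subrr; split; [exact: span0|].
- exists (N + M)%N, (u 0 0 ^+ M * r + u 0 0 ^+ N * q); split.
    have -> : u 0 0 ^+ (N + M) * (f + g) - (u 0 0 ^+ M * r + u 0 0 ^+ N * q) =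
      u 0 0 ^+ M * (u 0 0 ^+ N * f - r) + u 0 0 ^+ N * (u 0 0 ^+ M * g - q).
      by rewrite exprD; ring.
    by apply: span_lin => //; apply: span_mull.
  rewrite rmorphD tofracD !tofracM !tofracXn -fE -gE exprD.
  by set A := _ ^+ N; set B := _ ^+ M; ring.
- exists (N + M)%N, (r * q); split.
    have -> : u 0 0 ^+ (N + M) * (f * g) - r * q =
      (u 0 0 ^+ M * g) * (u 0 0 ^+ N * f - r) + r * (u 0 0 ^+ M * g - q).
      by rewrite exprD; ring.
    by apply: span_lin => //; apply: span_mull.
  rewrite rmorphM tofracM -fE -gE exprD.
  by set A := _ ^+ N; set B := _ ^+ M; ring.
have [->|mn] := eqVneq m n.+1; last first.
  exists 0%N, (V m 0 c); rewrite !expr0 !mul1r subrr chi_other //.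
  by split; first exact: span0.
exists 1%N, (V n.+1 0 0 * u 0 c); rewrite !expr1 chi_V // tofracM; split=> //.
apply/span3P; rewrite /= !crossE -/u.
have := I3_enum c.
rewrite !inE => /or3P[]/eqP->.
- by exists 0, 0, 0; ring.
- by exists 0, 0, 1; ring.
- by exists 0, (-1), 0; ring.
Qed.

Lemma P_power n f : (n.+1 < k)%N -> P n f ->
  exists N, ideal_span (coords (x n.+1)) (x n 0 0 ^+ N * f).
Proof.
move=> nk /(P_chi nk) f0; have [N [r [sf]]] := chi_elimination f nk.
rewrite f0 mulr0 => /eqP; rewrite eq_sym -tofrac0 tofrac_eq => /eqP r0.
by exists N; move: sf; rewrite r0 subr0.
Qed.

(** These are the two equations of P (n + 1): both vanish when V_(n+2) is a multiple
of x_(n+1), the cross product of x_n and V_(n+1). *)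
Let alpha n := dot (x n) (V n.+2).
Let beta n := dot (V n.+1) (V n.+2).

Lemma chainS_coords n m c : (n <= m)%N -> ideal_span (coords (x n)) (x m 0 c).
Proof.
move=> nm; rewrite -(subnK nm); elim: (m - n)%N c => [|d IHd] c.
  exact/span_mem/coordsP.
by rewrite addSn mxE; apply: span_sub; rewrite mulrC; apply: span_mull; apply: IHd.
Qed.

Lemma cross_cross n c :
  x n.+2 0 c = V n.+1 0 c * alpha n - x n 0 c * beta n.
Proof.
rewrite /alpha /beta /dot.
have := I3_enum c.
by rewrite !inE => /or3P[]/eqP->; rewrite [x n.+2]/= !crossE; ring.
Qed.

Lemma alpha_regular s n : (n.+2 < k)%N ->
  {in s, forall g, free_of (psi n.+2 1) g} -> regular s (x n 0 1) ->
  regular s (alpha n).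
Proof.
move=> nk frs rs.
have -> : alpha n = x n 0 1 * V n.+2 0 1 + (x n 0 0 * V n.+2 0 0 + x n 0 2 * V n.+2 0 2).
  by rewrite /alpha /dot; ring.
by apply: regularL => //; solve_free.
Qed.

(** With a = x_n, b = V_(n+1), u = a x b and y = V_(n+2), it suffices that u_0 is
regular modulo alpha and beta.  Two exchanges reduce this to: alpha is regular
modulo u_0, and beta modulo u_0 and alpha.  The latter is linear in b_0, with
coefficient y_0; a further exchange leaves alpha modulo u_0 and y_0. *)
Lemma P_linear n f : (n.+2 < k)%N -> P n.+1 f -> ideal_span [:: beta n; alpha n] f.
Proof.
move=> nk /(P_power nk)[N sf]; apply: (@regularXn _ _ (x n.+1 0 0) N); last first.
  apply: span_least (span_ideal _) _ sf; apply: coords_all => c.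
  rewrite cross_cross; apply: span_sub; apply: span_mull; apply: span_mem;
    by rewrite !inE eqxx ?orbT.
have nk' := ltnW nk; have nk2 := ltnW nk'.
have [u0 _] := chain_regular 0 nk'.
have [a1 a12] := chain_regular 1 nk2.
have uE : x n.+1 0 0 = - x n 0 2 * V n.+1 0 1 + x n 0 1 * V n.+1 0 2.
  by rewrite /= cross0; ring.
have ua1 : regular [:: x n.+1 0 0] (x n 0 1).
  apply: regular_swap => //; rewrite uE; apply: regularL => //; solve_free => //.
    by move=> g; rewrite inE => /eqP->; solve_free.
  exact: regularN.
have fu c : free_of (psi n.+2 c) (x n.+1 0 0) by solve_free.
have ualpha : regular [:: x n.+1 0 0] (alpha n).
  by apply: alpha_regular => // g; rewrite inE => /eqP->.
apply: regular_swap; first exact: regular_swap.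
have -> : beta n = V n.+2 0 0 * V n.+1 0 0 + (V n.+1 0 1 * V n.+2 0 1 + V n.+1 0 2 * V n.+2 0 2).
  by rewrite /beta /dot; ring.
apply: regularL => //; solve_free => //.
  by move=> g; rewrite !inE => /orP[]/eqP->; rewrite ?uE /alpha /dot; solve_free.
apply: (@regular_perm _ [:: alpha n; x n.+1 0 0]); try by move=> g; rewrite !inE orbC.
apply: regular_swap; first by apply: regularV => // g; rewrite inE => /eqP->.
apply: alpha_regular => //.
  by move=> g; rewrite !inE => /orP[]/eqP->; solve_free.
apply: regular_swap => //.
by apply: regularV => // g; rewrite !inE => /orP[]/eqP->; solve_free.
Qed.

(** The multiplier V_0,0 of [P_power] can be cancelled by [regular_cross], because
the entries of x_0 = V_0 and V_1 are distinct variables. *)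
Lemma P_minors f : (1 < k)%N -> P 0 f -> ideal_span (coords (x 1)) f.
Proof.
move=> k1 /(P_power k1)[N sf]; apply: regularXn sf.
have k0 := ltnW k1.
have Vreg c s : {in s, forall g, exists m c', g = V m 0 c' /\ (0%N, c) != (m, c')} ->
  regular s (V 0 0 c).
  by move=> sV; apply: regularV => // g /sV[m [c' [-> ne]]]; apply: psi_other.
have V1 : regular [:: x 0 0 0] (V 1 0 0).
  by apply: regularV => // g; rewrite inE => /eqP->; solve_free.
apply: regular_cross => //.
- exact: Vreg.
- by apply: Vreg => g; rewrite inE => /eqP->; exists 0%N, 0.
- by apply: Vreg => g; rewrite !inE => /orP[]/eqP->; [exists 0%N, 0|exists 0%N, 1].
apply: regularL => //; solve_free => //.
  by move=> g; rewrite !inE => /orP[]/eqP->; solve_free.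
by apply: Vreg => g; rewrite !inE => /orP[]/eqP->; [exists 0%N, 0|exists 1%N, 0].
Qed.

(** Let a = x_n and b = V_(n+1), so that x_(n+2) = alpha b - beta a.  When n = 0,
alpha (a x b) = a x (alpha b - beta a) = a x x_2.  When n > 0,
a = c x d for c = x_(n-1) and d = V_n, and P n has the equations c.b and d.b;
as c and d are orthogonal to a, alpha (c.b) = c.(alpha b - beta a) = c.x_(n+2),
and similarly for d. *)
Lemma alpha_P n f : (n.+2 < k)%N -> P n f ->
  ideal_span (coords (x n.+2)) (alpha n * f).
Proof.
case: n => [|n] nk.
  move=> /(P_minors (ltnW nk))/span_coords[h ->]; apply/span_coords.
  exists (cross h (x 0)); rewrite /alpha /dot [x 2]/= [x 1]/= !crossE /dot.
  by ring.
move=> /(P_linear (ltnW nk))/span2P[h0 [h1 ->]]; apply/span_coords.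
exists (h0 *: V n.+1 + h1 *: x n).
have dotE c : (h0 *: V n.+1 + h1 *: x n) 0 c = h0 * V n.+1 0 c + h1 * x n 0 c.
  by rewrite 3!mxE.
rewrite /dot !{}dotE !cross_cross /alpha /beta /dot [x n.+1]/= !crossE.
by ring.
Qed.

Lemma alpha_notin_P n : (n.+2 < k)%N -> ~ P n (alpha n).
Proof.
move=> nk /(P_fixed (ltnW nk)) E.
have nk' := ltnW nk; have nk2 := ltnW nk'.
have [r1 _] := chain_regular 1 nk2.
have /regular_neq0 : regular [::] (alpha n) by exact: alpha_regular.
rewrite E ?eqxx // /alpha /dot !rmorphD !rmorphM /= !chi_chain // !chi_other //.
all: by rewrite eqn_leq ltnn.
Qed.

Lemma beta_regular s n : (n.+2 < k)%N ->
  {in s, forall g, free_of (psi n.+2 0) g} -> regular s (V n.+1 0 0) ->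
  regular s (beta n).
Proof.
move=> nk frs rs.
have -> : beta n = V n.+1 0 0 * V n.+2 0 0 +
    (V n.+1 0 1 * V n.+2 0 1 + V n.+1 0 2 * V n.+2 0 2).
  by rewrite /beta /dot; ring.
by apply: regularL => //; solve_free.
Qed.

Lemma chain_inter m f : (m.+1 < k)%N -> (forall n, (n <= m)%N -> P n f) ->
  ideal_span (coords (x m.+1)) f.
Proof.
elim: m f => [|n IHn] f nk fP; first by apply: P_minors (fP _ _).
have nk' := ltnW nk; have nk2 := ltnW nk'.
have sf : ideal_span (coords (x n.+1)) f by apply: IHn => // i /leqW/fP.
have /span2P[h [g fE]] := P_linear nk (fP _ (leqnn _)).
(* Modulo the entries of x n, both f and alpha n vanish. *)
have : ideal_span (coords (x n)) h.
  apply: (_ : regular _ (beta n)).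
    have fx m c : (n < m < k)%N -> {in coords (x n), forall g, free_of (psi m c) g}.
      by move=> mn; apply: coords_all => c'; solve_free.
    apply: beta_regular => //; first by apply: fx; lia.
    by apply: regularV => //; apply: fx; lia.
  have -> : beta n * h = f - g * alpha n by rewrite fE; ring.
  apply: span_sub.
    apply: span_least (span_ideal _) _ sf; apply: coords_all => c.
    exact: chainS_coords.
  by apply: span_mull; apply/span_coords; exists (V n.+2); rewrite /alpha /dot; ring.
move=> /span_coords[h' hE].
(* Replacing x_n,c beta by V_(n+1),c alpha, modulo the entries of x_(n+2). *)
pose g' := g + dot h' (V n.+1).
have fE' : f = alpha n * g' - dot h' (x n.+2).
  by rewrite fE hE /g' /dot !cross_cross; ring.
have s2 : ideal_span (coords (x n.+2)) (dot h' (x n.+2)).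
  by apply/span_coords; exists h'.
rewrite fE'; apply: span_sub => //; apply: alpha_P => //.
have [Pid _ Pmul] := P_prime nk'.
have : P n (alpha n * g').
  have -> : alpha n * g' = f + dot h' (x n.+2) by rewrite {1}fE'; ring.
  apply: (@span_least _ (coords (x n.+1)) (P n)) => //.
    by apply: coords_all => c; apply: P_chain.
  apply: span_add => //; apply: span_least (span_ideal _) _ s2.
  by apply: coords_all => c; apply: chainS_coords.
by case/Pmul => // /(alpha_notin_P nk).
Qed.

Lemma chain_P n m c : (n < m)%N -> (m < k)%N -> P n (x m 0 c).
Proof.
move=> nm mk; have nk : (n.+1 < k)%N by apply: leq_ltn_trans mk.
apply: span_least (P_ideal nk) _ (chainS_coords c nm).
by apply: coords_all => i; apply: P_chain.
Qed.

(** For i < j the element V_j . V_(j+1) of P j has a nonzero image under [chi i]: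
either it is fixed, or j = i + 1 and its image is a multiple of
x_i . V_(i+2), which is not zero. *)
Lemma P_separated i j : (i.+1 < k)%N -> (j.+1 < k)%N -> i != j ->
  exists2 g, P j g & ~ P i g.
Proof.
move=> ik jk; rewrite neq_ltn => /orP[ij|ji]; last first.
  exists (x j.+1 0 0); first exact: P_chain.
  move/P_fixed => E; have [/regular_neq0] := chain_regular 0 jk.
  by rewrite E ?eqxx // chi_chain.
case: j => // j in jk ij *; rewrite ltnS in ij.
have jk' := ltnW jk; have jk2 := ltnW jk'.
have [u0 _] := chain_regular 0 jk'.
exists (beta j).
  have [Pid _ Pmul] := P_prime jk.
  have : P j.+1 (x j.+1 0 0 * beta j).
    apply: (@span_least _ (coords (x j.+2)) (P j.+1)) => //.
      by apply: coords_all => c; apply: P_chain.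
    apply/span3P; exists 0, (- V j.+1 0 2), (V j.+1 0 1).
    by rewrite /beta /dot /= !crossE; ring.
  case/Pmul => // /(P_fixed jk) E.
  by have /regular_neq0 := u0; rewrite E ?eqxx // chi_chain.
move=> /(P_chi ik) /eqP.
have [ij'|ij'] := eqVneq i j; last first.
  rewrite /beta /dot !rmorphD !rmorphM /= !chi_other //; try lia.
  rewrite -!tofracM -!tofracD tofrac_eq0; apply/negP/regular_neq0.
  by apply: beta_regular => //; apply: regularV.
rewrite {}ij' => /eqP b0.
have : (x j 0 0)%:F * chi j (beta j) = (V j.+1 0 0 * alpha j)%:F.
  rewrite /beta /alpha /dot !rmorphD !rmorphM /= ![chi j (V j.+2 0 _)]chi_other //; try lia.
  rewrite !mulrDr !mulrA !chi_V //; repeat rewrite ?tofracD ?tofracM ?mulrDr.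
  by rewrite !mulrA.
rewrite b0 mulr0 => /eqP; rewrite eq_sym tofrac_eq0 mulf_eq0 => /orP[]; apply/negP/regular_neq0.
  exact: regularV.
by apply: alpha_regular => //; case: (chain_regular 1 jk2).
Qed.

Lemma chain_span_inter f : (1 < k)%N ->
  ideal_span (coords (x k.-1)) f <-> forall n, (n.+1 < k)%N -> P n f.
Proof.
move=> k1; have kE : k = k.-2.+2 by lia.
split=> [sf n nk|fP]; last by rewrite kE; apply: chain_inter => [|n nk]; last apply: fP; lia.
apply: span_least (P_ideal nk) _ sf.
by apply: coords_all => c; apply: chain_P; lia.
Qed.

End Chain.

(** * Removing the reflections from the recursion *)

Section Twist.

Variable R : comNzRingType.
Implicit Types (a b : 'rV[R]_3) (v : nat -> 'rV[R]_3).

Definition twist n a := iter n (@diagS R) a.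

Definition twist_sign n (c : 'I_3) : R := (if c == ord_max then 1 else -1) ^+ n.

Lemma twistE n a c : twist n a 0 c = twist_sign n c * a 0 c.
Proof.
rewrite /twist_sign; elim: n => [|n IHn]; first by rewrite mul1r.
rewrite [twist _ _]/(diagS (twist n a)) mxE IHn exprS.
by case: ifP => cm; rewrite ?cm ?mul1r ?mulN1r ?mulNr.
Qed.

Lemma twist_signK n c : twist_sign n c * twist_sign n c = 1.
Proof.
by rewrite -exprMn; case: ifP => _; rewrite ?mulr1 ?mulrNN ?mulr1 expr1n.
Qed.

Lemma twistK n a : twist n (twist n a) = a.
Proof. by apply/rowP => c; rewrite !twistE mulrA twist_signK mul1r. Qed.

Lemma twistZ n l a : twist n (l *: a) = l *: twist n a.
Proof. by apply/rowP => c; rewrite twistE !mxE twistE; ring. Qed.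

Lemma twist_cross n a b : twist n (cross a b) = cross (twist n a) (twist n b).
Proof.
rewrite /twist; elim: n => //= n ->; set u := iter _ _ a; set v := iter _ _ b.
apply/rowP => c; have := I3_enum c.
have m2 : (2 : 'I_3) = ord_max by apply: val_inj.
have [n0 n1] : 0 != 2 :> 'I_3 /\ 1 != 2 :> 'I_3 by [].
rewrite !inE => /or3P[]/eqP->; rewrite !mxE -!m2 ?add0r ?I3_12 ?I3_21 ?I3_22.
all: by rewrite !eqxx ?(negbTE n0) ?(negbTE n1); ring.
Qed.

Lemma crossZr a l : cross a (l *: a) = 0.
Proof. by apply/rowP => c; rewrite !mxE; ring. Qed.

Lemma span_twist n a f :
  ideal_span (coords (twist n a)) f <-> ideal_span (coords a) f.
Proof.
have sub b g : ideal_span (coords (twist n b)) g -> ideal_span (coords b) g.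
  apply: span_least (span_ideal _) _; apply: coords_all => c.
  by rewrite twistE; apply/span_mull/span_mem/coordsP.
by split=> [/sub//|sf]; apply: sub; rewrite twistK.
Qed.

(** With truncated predecessor, the first two rows are not reflected; this is what
makes the recursion start correctly at w_2 = v_1 x v_2. *)
Definition twisted v n := twist n.-1 (v n).

(** Distributing the reflection of each step over the previous cross products. *)
Lemma w_chain v n : (1 < n)%N ->
  w (mkseq v n) = twist n.-2 (chain (twisted v) n.-1).
Proof.
case: n => [|[|n]] // _; elim: n => [//|n IHn].
rewrite mkseqS w_rcons ?size_mkseq // IHn [chain _ n.+2]/= twist_cross.
by rewrite {3}/twisted twistK.
Qed.

(** In terms of the reflected rows the last row is [l] times the product of the
previous ones, also in the exceptional case [n = 0]. *)
Lemma Phi_chain v n l :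
  Phi (mkseq v n.+1) l = rcons (mkseq v n.+1) (l *: twist n (chain (twisted v) n)).
Proof. by case: n => [//|n]; rewrite -[twist _ _]/(diagS (twist n _)) -(@w_chain v n.+2). Qed.

Lemma eq_chain v v' n : (forall m, (m <= n)%N -> v m = v' m) -> chain v n = chain v' n.
Proof.
elim: n => [|n IHn] vv' /=; first exact: vv'.
by rewrite vv' // IHn // => m /leqW/vv'.
Qed.

End Twist.

Section MapTwist.

Variables (R S : comNzRingType) (f : {rmorphism R -> S}).

Lemma map_twist n a : map_mx f (twist n a) = twist n (map_mx f a).
Proof.
apply/rowP => c; rewrite mxE !twistE mxE rmorphM; congr (_ * _).
by rewrite /twist_sign rmorphXn; case: ifP; rewrite ?rmorphN ?rmorph1.
Qed.

Lemma map_cross a b : map_mx f (cross a b) = cross (map_mx f a) (map_mx f b).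
Proof. by apply/rowP => c; rewrite !mxE rmorphB !rmorphM. Qed.

Lemma map_chain v n : map_mx f (chain v n) = chain (fun m => map_mx f (v m)) n.
Proof. by elim: n => //= n IHn; rewrite map_cross IHn. Qed.

End MapTwist.

(** * The parametrizations of the components *)

Lemma mpoly_generation N (F : fieldType) (Q : {mpoly F[N]} -> Prop) :
  (forall c, Q c%:MP) -> (forall f g, Q f -> Q g -> Q (f + g)) ->
  (forall f g, Q f -> Q g -> Q (f * g)) -> (forall i, Q 'X_i) -> forall f, Q f.
Proof.
move=> QC QD QM QX; elim/mpolyind => [|c m p _ _ Qp]; first by rewrite -mpolyC0.
apply: (QD) => //; rewrite -mul_mpolyC; apply: (QM) => //.
rewrite mpolyXE_id; apply: (big_rec Q) => [|i q _ Qq]; first by rewrite -mpolyC1.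
apply: (QM) => //; elim: (m i) => [|n IHn]; first by rewrite expr0 -mpolyC1.
by rewrite exprS; apply: QM.
Qed.

Section Parametrization.

Variable F : fieldType.

Lemma nth_vars N n (e : 'I_(n * 3) -> 'I_N) (i : 'I_n) c :
  nth 0 (vars F e) i 0 c = 'X_(e (mxvec_index i c)).
Proof.
by rewrite (nth_map i) ?size_enum_ord // nth_ord_enum mxE.
Qed.

Lemma vars_mkseq N n (e : 'I_(n * 3) -> 'I_N) :
  vars F e = mkseq (nth 0 (vars F e)) n.
Proof. by rewrite -{1}(mkseq_nth 0 (vars F e)) size_map size_enum_ord. Qed.

Lemma rmorph_twist_sign (R S : comNzRingType) (f : {rmorphism R -> S}) n c :
  f (twist_sign R n c) = twist_sign S n c.
Proof. by rewrite /twist_sign rmorphXn; case: ifP; rewrite ?rmorphN ?rmorph1. Qed.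

Section Eval.

Variables (k : nat) (S : comNzRingType) (f : {rmorphism F -> S}).
Variable u : nat -> 'rV[S]_3.
Definition eval_triples : {rmorphism {mpoly F[k * 3]} -> S} :=
  mmap f (fun l => mxvec (\matrix_(i < k, c < 3) u i 0 c) 0 l).

Lemma eval_triplesX (i : 'I_k) c : eval_triples 'X_(mxvec_index i c) = u i 0 c.
Proof. by rewrite /eval_triples /= mmapX mmap1U mxvecE mxE. Qed.

Lemma eval_triplesC c : eval_triples c%:MP = f c.
Proof. exact: mmapC. Qed.

End Eval.

Variable k : nat.
Local Notation R := {mpoly F[k * 3]}.

Definition var_row n : 'rV[R]_3 := nth 0 (vars F (@id 'I_(k * 3))) n.
Let V := twisted var_row.

Lemma var_rowE (i : 'I_k) c : var_row i 0 c = 'X_(mxvec_index i c).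
Proof. exact: nth_vars. Qed.

Lemma var_row_default n : (k <= n)%N -> var_row n = 0.
Proof. by move=> kn; rewrite /var_row nth_default // size_map size_enum_ord. Qed.

Lemma eval_var_row (S : comNzRingType) (f : {rmorphism F -> S}) u n c : (n < k)%N ->
  eval_triples k f u (var_row n 0 c) = u n 0 c.
Proof. by move=> nk; rewrite (var_rowE (Ordinal nk)) eval_triplesX. Qed.

Lemma triples_generation (Q : R -> Prop) :
  (forall c, Q c%:MP) -> (forall f g, Q f -> Q g -> Q (f + g)) ->
  (forall f g, Q f -> Q g -> Q (f * g)) -> (forall n c, Q (V n 0 c)) ->
  forall f, Q f.
Proof.
move=> QC QD QM QV; apply: mpoly_generation => // l.
case/mxvec_indexP: l => i c; rewrite -var_rowE -(twistK i.-1 (var_row i)) twistE.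
apply: QM; last exact: QV.
have := QC (twist_sign F i.-1 c).
by rewrite (rmorph_twist_sign (@mpolyC (k * 3) F)).
Qed.

Definition subst_poly n c : {rmorphism R -> {poly R}} :=
  eval_triples k (polyC \o @mpolyC (k * 3) F)
    (fun m => \row_c' if (m == n) && (c' == c) then twist_sign _ n.-1 c * 'X
                      else (var_row m 0 c')%:P).

Lemma subst_polyV n c : (n < k)%N -> subst_poly n c (V n 0 c) = 'X.
Proof.
move=> nk; rewrite twistE rmorphM rmorph_twist_sign eval_var_row // mxE !eqxx.
by rewrite mulrA twist_signK mul1r.
Qed.

Lemma subst_poly_other n c m c' : (n < k)%N -> (n, c) != (m, c') ->
  subst_poly n c (V m 0 c') = (V m 0 c')%:P.
Proof.
move=> nk; rewrite xpair_eqE [n == m]eq_sym [c == c']eq_sym => /negbTE ne.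
rewrite twistE rmorphM rmorph_twist_sign polyCM.
rewrite -[(twist_sign R _ _)%:P]/(polyC (twist_sign R _ _)) (rmorph_twist_sign polyC).
have [mk|km] := ltnP m k; first by rewrite eval_var_row // mxE ne.
by rewrite var_row_default // mxE rmorph0.
Qed.

Lemma subst_polyK n c f : (n < k)%N -> (subst_poly n c f).[V n 0 c] = f.
Proof.
move=> nk; elim/triples_generation: f => [a|f g fE gE|f g fE gE|m c'].
- by rewrite eval_triplesC hornerC.
- by move: (subst_poly n c) fE gE => s {2}<- {2}<-; rewrite rmorphD hornerD.
- by move: (subst_poly n c) fE gE => s {2}<- {2}<-; rewrite rmorphM hornerM.
have [/eqP[<- <-]|ne] := boolP ((n, c) == (m, c')).
  by rewrite subst_polyV // hornerX.
by rewrite subst_poly_other // hornerC.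
Qed.

Definition param_p n := nth 0
  (vars F (fun l : 'I_(n.+1 * 3) => lshift ((k - n.+2) * 3) (lshift 1 l))).
Definition param_lambda n : {mpoly F[n.+1 * 3 + 1 + (k - n.+2) * 3]} :=
  'X_(lshift _ (rshift _ ord0)).
Definition param_q n := nth 0
  (vars F (fun l : 'I_((k - n.+2) * 3) => rshift (n.+1 * 3 + 1) l)).

Lemma psi_pointE n : psi_point F k n.+2 =
  rcons (mkseq (param_p n) n.+1)
    (param_lambda n *: twist n (chain (twisted (param_p n)) n)) ++
  mkseq (param_q n) (k - n.+2).
Proof. by rewrite -Phi_chain /psi_point /Psi -!vars_mkseq. Qed.

Lemma nth_psi_point n m : (m < k)%N -> nth 0 (psi_point F k n.+2) m =
  if (m < n.+1)%N then param_p n m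
  else if m == n.+1 then param_lambda n *: twist n (chain (twisted (param_p n)) n)
  else param_q n (m - n.+2).
Proof.
move=> mk; rewrite psi_pointE nth_cat size_rcons size_mkseq ltnS leq_eqVlt.
rewrite nth_rcons size_mkseq.
have [mn|mn|->] := ltngtP m n.+1; rewrite ?orbT ?eqxx //=.
  by rewrite nth_mkseq.
by rewrite nth_mkseq //; lia.
Qed.

Definition phi_morph n : {rmorphism R -> {mpoly F[n.+1 * 3 + 1 + (k - n.+2) * 3]}} :=
  comp_mpoly [tuple mxvec (\matrix_(i < k, c < 3) nth 0 (psi_point F k n.+2) i 0 c) 0 l
             | l < k * 3].

Lemma phi_var_row n m : (m < k)%N ->
  map_mx (phi_morph n) (var_row m) = nth 0 (psi_point F k n.+2) m.
Proof.
move=> mk; apply/rowP => c; rewrite mxE (var_rowE (Ordinal mk)).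
exact: (@phi_var F k n.+2 (Ordinal mk) c).
Qed.

(** The point of the parameter space of [psi_point] at which the reflected row
n + 1 is the multiple of x_n with entry V_(n+1),0 in position 0.  It lives over the
fraction field, as lambda has denominator x_n,0. *)
Definition param_eval n :
    {rmorphism {mpoly F[n.+1 * 3 + 1 + (k - n.+2) * 3]} -> {fraction R}} :=
  mmap (@FracField.tofrac R \o @mpolyC (k * 3) F)
    (fun l => match split l with
      | inl l' => match split l' with
        | inl l1 => mxvec (\matrix_(i < n.+1, c < 3) (var_row i 0 c)%:F) 0 l1
        | inr _ => (V n.+1 0 0)%:F / (chain V n 0 0)%:F
        end
      | inr l2 => mxvec (\matrix_(i < k - n.+2, c < 3) (var_row (i + n.+2) 0 c)%:F) 0 l2
      end).

Lemma param_eval_p n m : (m < n.+1)%N ->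
  map_mx (param_eval n) (param_p n m) = map_mx (@FracField.tofrac R) (var_row m).
Proof.
move=> mn; apply/rowP => c; rewrite !mxE /param_p (nth_vars _ (Ordinal mn)).
rewrite /= mmapX mmap1U (unsplitK (inl _)) (unsplitK (inl _)).
by rewrite mxvecE mxE.
Qed.

Lemma param_eval_lambda n :
  param_eval n (param_lambda n) = (V n.+1 0 0)%:F / (chain V n 0 0)%:F.
Proof.
by rewrite /= mmapX mmap1U (unsplitK (inl _)) (unsplitK (inr _)).
Qed.

Lemma param_eval_q n m : (n.+2 + m < k)%N ->
  map_mx (param_eval n) (param_q n m) = map_mx (@FracField.tofrac R) (var_row (m + n.+2)).
Proof.
move=> mn; have mn' : (m < k - n.+2)%N by lia.
apply/rowP => c; rewrite !mxE /param_q (nth_vars _ (Ordinal mn')).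
rewrite /= mmapX mmap1U (unsplitK (inr _)).
by rewrite mxvecE mxE.
Qed.

Definition chi n : {rmorphism R -> {fraction R}} := param_eval n \o phi_morph n.

Lemma chiC n c : chi n c%:MP = (c%:MP)%:F.
Proof. by rewrite /= comp_mpolyC mmapC. Qed.

Lemma map_chi n (a : 'rV[R]_3) :
  map_mx (chi n) a = map_mx (param_eval n) (map_mx (phi_morph n) a).
Proof. by apply/rowP => c; rewrite !mxE. Qed.

Lemma chi_var_row n m : m != n.+1 ->
  map_mx (chi n) (var_row m) = map_mx (@FracField.tofrac R) (var_row m).
Proof.
move=> mn; have [mk|km] := ltnP m k; last first.
  by rewrite var_row_default //; apply/rowP => c; rewrite !mxE !rmorph0.
rewrite map_chi phi_var_row // nth_psi_point // (negbTE mn).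
case: ltnP => nm; first exact: param_eval_p.
have nm2 : (n.+2 <= m)%N by rewrite ltn_neqAle eq_sym mn.
by rewrite param_eval_q ?subnK ?subnKC.
Qed.

Lemma chi_other n m c : m != n.+1 -> chi n (V m 0 c) = (V m 0 c)%:F.
Proof.
move=> mn; have := congr1 (fun a : 'rV_3 => twist m.-1 a 0 c) (chi_var_row mn).
by rewrite -!map_twist mxE => ->; rewrite mxE.
Qed.

Lemma phi_V n m : (m <= n)%N -> (n < k)%N ->
  map_mx (phi_morph n) (V m) = twisted (param_p n) m.
Proof.
move=> mn nk; have mk := leq_ltn_trans mn nk.
by rewrite map_twist phi_var_row // nth_psi_point // ltnS mn.
Qed.

Lemma phi_chain n m : (m <= n)%N -> (n < k)%N ->
  map_mx (phi_morph n) (chain V m) = chain (twisted (param_p n)) m.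
Proof.
move=> mn nk; rewrite map_chain; apply: eq_chain => i im.
by apply: phi_V => //; apply: leq_trans mn.
Qed.

(** The two reflections, in the parametrization and in the definition of the rows,
cancel. *)
Lemma phi_V_last n : (n.+1 < k)%N ->
  map_mx (phi_morph n) (V n.+1) =
  param_lambda n *: chain (twisted (param_p n)) n.
Proof.
move=> nk; rewrite map_twist phi_var_row // nth_psi_point // ltnn eqxx.
by rewrite twistZ twistK.
Qed.

Lemma chain_ideal_P n c : (n.+1 < k)%N -> ideal_P F k n.+2 (chain V n.+1 0 c).
Proof.
move=> nk; have : map_mx (phi_morph n) (chain V n.+1) = 0.
  by rewrite map_cross phi_V_last // phi_chain ?crossZr // ltnW.
by move/rowP/(_ c); rewrite !mxE.
Qed.

Lemma chi_V n c : (n.+1 < k)%N -> chain V n 0 0 != 0 ->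
  (chain V n 0 0)%:F * chi n (V n.+1 0 c) = (V n.+1 0 0)%:F * (chain V n 0 c)%:F.
Proof.
move=> nk u0; have : map_mx (chi n) (V n.+1) =
    ((V n.+1 0 0)%:F / (chain V n 0 0)%:F) *: map_mx (@FracField.tofrac R) (chain V n).
  rewrite map_chi phi_V_last // map_mxZ param_eval_lambda; congr (_ *: _).
  rewrite -(phi_chain (leqnn n) (ltnW nk)) -map_chi.
  rewrite (map_chain (chi n)) (map_chain (@FracField.tofrac R)).
  apply: eq_chain => m mn; apply/rowP => c'; rewrite !mxE; apply: chi_other.
  by rewrite neq_ltn ltnS mn.
move/rowP/(_ c); rewrite !mxE => ->.
by rewrite mulrCA mulrA divfK ?tofrac_eq0 // mulrC.
Qed.

Lemma prime_ideal_P n : prime_ideal (ideal_P F k n.+2).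
Proof.
have E f : ideal_P F k n.+2 f <-> phi_morph n f = 0 by [].
split.
- by split=> [|a f g /E Ef /E Eg]; apply/E; rewrite ?rmorph0 // rmorphD rmorphM Ef Eg mulr0 addr0.
- by move/E/eqP; rewrite rmorph1 oner_eq0.
- by move=> f g /E/eqP; rewrite rmorphM mulf_eq0 => /orP[]/eqP; [left|right].
Qed.

Lemma ideal_P_chi n f : ideal_P F k n.+2 f -> chi n f = 0.
Proof. by move=> Pf; rewrite /= [comp_mpoly _ _]Pf rmorph0. Qed.

Lemma ideal_I_span f : (1 < k)%N ->
  ideal_I F k f <-> ideal_span (coords (chain V k.-1)) f.
Proof.
move=> k1; rewrite -(span_twist k.-2) -w_chain // -vars_mkseq.
by split=> [[h ->]|/span_sum[h ->]]; [apply/span_sum; exists h | exists h].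
Qed.

End Parametrization.

Theorem theorem44 (F : fieldType) (k : nat)
    (char_neq2 : 2%N \notin [pchar F]) (k_ge2 : (2 <= k)%N) :
  [/\ forall j : nat, (2 <= j <= k)%N ->
        [/\ prime_ideal (ideal_P F k j), irreducible_ideal (ideal_P F k j),
            radical_ideal (ideal_P F k j) & primary_ideal (ideal_P F k j)],
      irredundant_primary_decomposition (ideal_I F k)
        (fun i : 'I_k.-1 => ideal_P F k i.+2) &
      forall (m : nat) (Q : 'I_m -> {mpoly F[k * 3]} -> Prop),
        irredundant_primary_decomposition (ideal_I F k) Q ->
        m = k.-1 /\
        exists sigma : 'I_m -> 'I_k.-1, bijective sigma /\
          forall i : 'I_m, same_ideal (Q i) (ideal_P F k (sigma i).+2)].
Proof.
have psiK := @subst_polyK F k; have psiV := @subst_polyV F k.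
have psi_other := @subst_poly_other F k.
pose V := twisted (@var_row F k).
have u0 n : (n.+1 < k)%N -> chain V n 0 0 != 0.
  move=> nk; apply: regular_neq0.
  by case: (chain_regular psiK psiV psi_other 0 (ltnW nk)).
have gen (Q : {mpoly F[k * 3]} -> Prop) :
    (forall f, (forall n, chi F k n f = f%:F) -> Q f) ->
    (forall f g, Q f -> Q g -> Q (f + g)) ->
    (forall f g, Q f -> Q g -> Q (f * g)) ->
    (forall n c, Q (V n 0 c)) -> forall f, Q f.
  move=> QC QD QM QV; apply: triples_generation => // c.
  by apply: QC => n; apply: chiC.
have chi_o n m c : (n.+1 < k)%N -> m != n.+1 -> chi F k n (V m 0 c) = (V m 0 c)%:F.
  by move=> _; apply: chi_other.
have chi_v n c (nk : (n.+1 < k)%N) := chi_V c nk (u0 n nk).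
have prime_P n (_ : (n.+1 < k)%N) := @prime_ideal_P F k n.
have chain_P n c := @chain_ideal_P F k n c.
have P_chi n f (_ : (n.+1 < k)%N) := @ideal_P_chi F k n f.
have inter f : ideal_I F k f <-> forall i : 'I_k.-1, ideal_P F k i.+2 f.
  rewrite ideal_I_span //.
  rewrite (chain_span_inter psiK psiV psi_other gen chi_o chi_v prime_P chain_P P_chi) //.
  split=> [fP i|fP n nk]; first by apply: fP; have := ltn_ord i; lia.
  have nk' : (n < k.-1)%N by lia.
  exact: (fP (Ordinal nk')).
have separated (i j : 'I_k.-1) : i != j ->
    exists2 g, ideal_P F k j.+2 g & ~ ideal_P F k i.+2 g.
  have lt (l : 'I_k.-1) : (l.+1 < k)%N by have := ltn_ord l; lia.
  exact: (P_separated psiK psiV psi_other chi_o chi_v prime_P chain_P P_chi (lt i) (lt j)).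
have prime_i (i : 'I_k.-1) := @prime_ideal_P F k i.
split.
- case=> [|[|n]] // _; have pP := @prime_ideal_P F k n.
  by split=> //; [exact: prime_irreducible|exact: prime_radical|exact: prime_primary].
- exact: prime_decomposition.
- exact: prime_decomposition_unique prime_i inter separated.
Qed.
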